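(* Let $m_0>0$. Let $S_0=0$ and $S_{j+1}=S_j+m_0(\sqrt5/2)^j$ for all integers $j\ge0$, and let $d_j=\left(\frac{\sqrt5}{\sqrt5+1}\right)^j$ for all $j\ge0$. Let $F:\mathbb{R}\to\mathbb{R}$ be the function built from $(S_j)$ and $(d_j)$ as described in the context. If $\theta_0=0$ and $(\theta_j)_{j\ge1}$ are generated by the Lipschitz approximation method with initial step size $m_0$ (described in the context) applied to $F$, then $\lim_j F(\theta_j)=\infty$.
   Context: $\dot F$ denotes the derivative of $F$. Lipschitz approximation method (one-dimensional case), with initial point $\theta_0$ and $m_0>0$: set $w_0=+\infty$ and $\theta_1=\theta_0-m_0\dot F(\theta_0)$; for $k=1,2,\dots$ set $$m_k=\min\left\{\sqrt{1+w_{k-1}}\,m_{k-1},\ \frac{|\theta_k-\theta_{k-1}|}{2|\dot F(\theta_k)-\dot F(\theta_{k-1})|}\right\},\quad \theta_{k+1}=\theta_k-m_k\dot F(\theta_k),\quad w_k=\frac{m_k}{m_{k-1}}$$ (so for $k=1$ the first term in the minimum is $+\infty$). For $m>0$ and $d,\delta\in(0,1]$ let $f(\cdot\,;m,d,\delta):[0,m]\to\mathbb{R}$ be given by $$f(\theta;m,d,\delta)=\begin{cases} -d\theta & \theta\in(0,\frac{2-d}{16}m)\\ \frac{8}{m}(\theta-\frac m8)^2-m\frac{-d^2+4d}{32} & \theta\in[\frac{2-d}{16}m,\frac{3}{16}m)\\ -\frac{5m}{16}\exp\left(\frac{5/16}{\theta/m-1/2}+1\right)+m\frac{11+d^2-4d}{32}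 & \theta\in(\frac{3}{16}m,\frac12 m)\\ m\frac{11+d^2-4d}{32} & \theta=\frac12 m\\ \frac{5m}{16}\exp\left(\frac{-5/16}{\theta/m-1/2}+1\right)+m\frac{11+d^2-4d}{32} & \theta\in(\frac12 m,\frac{13}{16}m)\\ -\frac{8}{m}(\theta-\frac{7m}{8})^2+m\frac{22+d^2-4d}{32} & \theta\in[\frac{13}{16}m,\frac{\delta+14}{16}m)\\ -\delta\theta+m\frac{22+d^2+\delta^2-4d+28\delta}{32} & \theta\in[\frac{\delta+14}{16}m,m] \end{cases}$$ and extended to $\theta=0$ and $\theta=\frac{3}{16}m$ by continuity. Given a strictly increasing real sequence $(S_j)_{j\ge0}$ and a sequence $(d_j)_{j\ge 0}$ in $(0,1]$, the function $F$ is defined (recursively in $j$) on $(-\infty,\sup_j S_j)$ by $F(\theta)=-d_0(\theta-S_0)$ for $\theta\le S_0$; $F(\theta)=f(\theta-S_0;S_1-S_0,d_0,d_1)$ for $\theta\in(S_0,S_1]$; and $F(\theta)=f(\theta-S_j;S_{j+1}-S_j,d_j,d_{j+1})+F(S_j)$ for $\theta\in(S_j,S_{j+1}]$, $j=1,2,\dots$. It is defined on all of $\mathbb{R}$ when $\sup_j S_j=\infty$. *)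

(* Defs.v *)
From HB Require Import structures.
From mathcomp Require Import all_boot all_order all_algebra.
From mathcomp Require Import all_classical all_reals all_analysis.

Set Implicit Arguments.
Unset Strict Implicit.
Unset Printing Implicit Defensive.

Import Order.TTheory GRing.Theory Num.Theory.
Import numFieldNormedType.Exports.

Local Open Scope classical_set_scope.
Local Open Scope ring_scope.

Section Ramp.
Context {R : realType}.
Implicit Types m d delta theta : R.

(* The table leaves theta = 0 and theta = 3/16 m undefined; the value 0 taken
   there, and outside [0, m], is a placeholder. *)
Definition ramp_table m d delta theta : R :=
  if theta \in `]0, (2 - d) / 16 * m[ then
    - d * theta
  else if theta \in `[(2 - d) / 16 * m, 3 / 16 * m[ then
    8 / m * (theta - m / 8) ^+ 2 - m * ((- d ^+ 2 + 4 * d) / 32)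
  else if theta \in `]3 / 16 * m, 1 / 2 * m[ then
    - (5 * m / 16) * expR ((5 / 16) / (theta / m - 1 / 2) + 1)
      + m * ((11 + d ^+ 2 - 4 * d) / 32)
  else if theta == 1 / 2 * m then
    m * ((11 + d ^+ 2 - 4 * d) / 32)
  else if theta \in `]1 / 2 * m, 13 / 16 * m[ then
    5 * m / 16 * expR (- (5 / 16) / (theta / m - 1 / 2) + 1)
      + m * ((11 + d ^+ 2 - 4 * d) / 32)
  else if theta \in `[13 / 16 * m, (delta + 14) / 16 * m[ then
    - (8 / m) * (theta - 7 * m / 8) ^+ 2 + m * ((22 + d ^+ 2 - 4 * d) / 32)
  else if theta \in `[(delta + 14) / 16 * m, m] then
    - delta * theta
      + m * ((22 + d ^+ 2 + delta ^+ 2 - 4 * d + 28 * delta) / 32)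
  else 0.

(* f(theta; m, d, delta): the table extended by continuity, from the right at
   the left endpoint 0 of the domain and from both sides at 3/16 m. *)
Definition ramp m d delta theta : R :=
  if theta == 0 then
    lim (ramp_table m d delta x @[x --> (0 : R)^'+])
  else if theta == 3 / 16 * m then
    lim (ramp_table m d delta x @[x --> (3 / 16 * m)^'])
  else ramp_table m d delta theta.

End Ramp.

Section Glued.
Context {R : realType}.
Variables s d : nat -> R.

Definition piece (j : nat) (theta : R) : R :=
  ramp (s j.+1 - s j) (d j) (d j.+1) (theta - s j).

(* The value F(s_j), see [glued_node] below. *)
Fixpoint node (j : nat) : R :=
  if j is i.+1 then piece i (s i.+1) + node i else 0.

(* For strictly increasing s, at most one j satisfies s_j < theta <= s_(j+1),
   and there is one as soon as s_0 < theta < sup_j s_j. The lemmas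
   [glued_left], [glued_first] and [glued_next] are the defining equations. *)
Definition glued (theta : R) : R :=
  if theta <= s 0%N then - d 0%N * (theta - s 0%N)
  else let j := xget 0%N [set j | s j < theta <= s j.+1] in
       piece j theta + node j.

Hypothesis s_incr : {homo s : i j / (i < j)%N >-> i < j}.

Let glued_piece (j : nat) (theta : R) :
  s j < theta <= s j.+1 -> glued theta = piece j theta + node j.
Proof.
move=> jP; have s_le : {homo s : i k / (i <= k)%N >-> i <= k}.
  by move=> i k; rewrite leq_eqVlt => /predU1P[->//|/s_incr/ltW].
have /andP[lt_j le_j] := jP.
rewrite /glued leNgt (le_lt_trans (s_le _ _ (leq0n j)) lt_j) /=.
rewrite (@xget_unique _ _ _ j)// => i /andP[lt_i le_i].
apply/eqP; rewrite eqn_leq; apply/andP; split; rewrite leqNgt; apply/negP.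
- by move=> /s_le le_ji; have := le_lt_trans (le_trans le_j le_ji) lt_i;
    rewrite ltxx.
- by move=> /s_le le_ij; have := le_lt_trans (le_trans le_i le_ij) lt_j;
    rewrite ltxx.
Qed.

Lemma glued_node (j : nat) : glued (s j) = node j.
Proof.
case: j => [|j]; first by rewrite /glued lexx subrr mulr0.
by rewrite (glued_piece (j := j))// lexx s_incr.
Qed.

Lemma glued_left (theta : R) :
  theta <= s 0%N -> glued theta = - d 0%N * (theta - s 0%N).
Proof. by rewrite /glued => ->. Qed.

Lemma glued_first (theta : R) : s 0%N < theta <= s 1%N ->
  glued theta = ramp (s 1%N - s 0%N) (d 0%N) (d 1%N) (theta - s 0%N).
Proof. by move=> /glued_piece ->; rewrite addr0. Qed.

Lemma glued_next (j : nat) (theta : R) : (1 <= j)%N ->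
  s j < theta <= s j.+1 ->
  glued theta = ramp (s j.+1 - s j) (d j) (d j.+1) (theta - s j) + glued (s j).
Proof. by move=> _ /glued_piece ->; rewrite glued_node. Qed.

End Glued.

(* The ratio is taken in \bar R, so that a positive numerator over a zero
   denominator is +oo; w 0 = +oo makes the first term of the minimum +oo for
   k = 1. *)
Record lipschitz_approximation {R : realType} (F : R -> R) (theta0 m0 : R)
    (theta m : nat -> R) (w : nat -> \bar R) : Prop := {
  la_theta0 : theta 0%N = theta0 ;
  la_m0 : m 0%N = m0 ;
  la_w0 : w 0%N = +oo%E ;
  la_theta1 : theta 1%N = theta0 - m0 * F^`()%classic theta0 ;
  la_m : forall k, (1 <= k)%N ->
    (m k)%:E = Order.min (sqrte (1 + w k.-1) * (m k.-1)%:E)%E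
      (`|theta k - theta k.-1|%:E /
         (2 * `|F^`()%classic (theta k) - F^`()%classic (theta k.-1)|)%:E)%E ;
  la_theta : forall k, (1 <= k)%N ->
    theta k.+1 = theta k - m k * F^`()%classic (theta k) ;
  la_w : forall k, (1 <= k)%N -> w k = (m k / m k.-1)%:E
}.

(* Main.v *)
Require Import Defs.
From HB Require Import structures.
From mathcomp Require Import all_boot all_order all_algebra.
From mathcomp Require Import all_classical all_reals all_analysis.
From mathcomp Require Import ring lra.

Import Order.TTheory GRing.Theory Num.Theory.
Import numFieldNormedType.Exports.

Local Open Scope classical_set_scope.
Local Open Scope ring_scope.

(** The method visits exactly the nodes: theta_k = s_k for every k, although
    the values of F there grow without bound.

    Near each node F is affine with slope - d_j, because each ramp begins with
    the slope - d_j and ends with the slope - d_(j+1) ([glued_near_node]); so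
    the method, started at s_0, sees only the slopes - d_j as long as its
    iterates are nodes. Let phi = (1 + sqrt 5) / 2 be the golden ratio. The step
    sizes turn out to be m_k = m_0 phi ^ k, for three reasons:
    - phi * (sqrt 5 / (sqrt 5 + 1)) = sqrt 5 / 2, so such a step multiplied by
      the slope d_k is the gap s_(k+1) - s_k: the next iterate is the next node;
    - the secant term of the minimum, between two consecutive nodes, is then
      m_0 phi ^ (k+1), because d_k - d_(k+1) = d_k / (sqrt 5 + 1) and
      (sqrt 5 + 1) / 2 = phi;
    - the growth term agrees with it: once w_k = phi, the factor
      sqrt (1 + w_k) is again phi, by phi ^ 2 = 1 + phi. For k = 1 the growth
      term is +oo and the secant term is taken.

    On the other hand, a ramp on a gap of length m climbs by at least m / 2
    between its endpoints ([ramp_end_ge]), the short descents at both ends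
    notwithstanding. The gaps are at least m_0, so F(s_j) tends to +oo. *)

(** As d <= 1, the first affine branch, which stops at (2 - d) / 16 * m, covers
    the first sixteenth of the interval whatever d is. *)
Lemma ramp_start (R : realType) (m d delta x : R) :
  0 < m -> 0 < d <= 1 -> 0 < x < m / 16 -> ramp m d delta x = - d * x.
Proof.
move=> m_gt0 /andP[d_gt0 d_le1] /andP[x_gt0 x_lt].
have dm_gt0 : 0 < d * m by rewrite mulr_gt0.
have dm_le : d * m <= m by rewrite ler_piMl// ltW.
rewrite /ramp ifF; last by rewrite gt_eqF.
rewrite ifF; last by apply/eqP => x_eq; lra.
by rewrite /ramp_table in_itv /= ifT//; apply/andP; split; lra.
Qed.

(** As delta <= 1, the last affine branch, which starts at (delta + 14) / 16 * m,
    covers the last sixteenth of the interval whatever delta is. *)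
Lemma ramp_tail (R : realType) (m d delta x : R) :
  0 < m -> 0 < d <= 1 -> 0 < delta <= 1 -> 15 / 16 * m <= x <= m ->
  ramp m d delta x = - delta * x
    + m * ((22 + d ^+ 2 + delta ^+ 2 - 4 * d + 28 * delta) / 32).
Proof.
move=> m_gt0 /andP[d_gt0 d_le1] /andP[e_gt0 e_le1] /andP[x_ge x_le].
have dm_gt0 : 0 < d * m by rewrite mulr_gt0.
have dm_le : d * m <= m by rewrite ler_piMl// ltW.
have em_gt0 : 0 < delta * m by rewrite mulr_gt0.
have em_le : delta * m <= m by rewrite ler_piMl// ltW.
rewrite /ramp ifF; last by apply/eqP => x_eq; lra.
rewrite ifF; last by apply/eqP => x_eq; lra.
rewrite /ramp_table !in_itv /=.
do 3 (rewrite ifF; last by apply/negP => /andP[? ?]; lra).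
rewrite ifF; last by apply/eqP => x_eq; lra.
do 2 (rewrite ifF; last by apply/negP => /andP[? ?]; lra).
by rewrite ifT//; apply/andP; split; lra.
Qed.

Lemma ramp_finish (R : realType) (m d delta x : R) :
  0 < m -> 0 < d <= 1 -> 0 < delta <= 1 -> 15 / 16 * m <= x <= m ->
  ramp m d delta x = ramp m d delta m - delta * (x - m).
Proof.
move=> m_gt0 d01 e01 x_itv; rewrite !ramp_tail//; first by ring.
by apply/andP; split; lra.
Qed.

(** The final value is m / 32 * (22 + (d ^ 2 - 4 d) + (delta ^ 2 - 4 delta)),
    and a ^ 2 - 4 a decreases on ]0, 1], to - 3 at a = 1; 22 - 3 - 3 = 16. *)
Lemma ramp_end_ge (R : realType) (m d delta : R) :
  0 < m -> 0 < d <= 1 -> 0 < delta <= 1 -> m / 2 <= ramp m d delta m.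
Proof.
move=> m_gt0 d01 e01; rewrite ramp_tail//; last by apply/andP; split; lra.
have quad_ge (a : R) : 0 < a <= 1 -> - 3 <= a ^+ 2 - 4 * a.
  move=> /andP[a_gt0 a_le1].
  have : 0 <= (1 - a) * (3 - a) by rewrite mulr_ge0// subr_ge0//; lra.
  by rewrite expr2; lra.
rewrite -subr_ge0.
rewrite (_ : _ - _ = m * ((d ^+ 2 - 4 * d + 3)
  + (delta ^+ 2 - 4 * delta + 3)) / 32); last by field.
rewrite divr_ge0// mulr_ge0 ?(ltW m_gt0)//.
by have := quad_ge _ d01; have := quad_ge _ e01; lra.
Qed.

Section GluedNodes.
Context {R : realType} {s d : nat -> R}.
Hypothesis s_lt : forall j, s j < s j.+1.
Hypothesis d01 : forall j, 0 < d j <= 1.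

Let s_incr : {homo s : i j / (i < j)%N >-> i < j}.
Proof. by apply: homo_ltn => // y x z; apply: lt_trans. Qed.

Let gap_gt0 j : 0 < s j.+1 - s j. Proof. by rewrite subr_gt0. Qed.

Lemma glued_gap j theta : s j < theta <= s j.+1 ->
  glued s d theta
    = ramp (s j.+1 - s j) (d j) (d j.+1) (theta - s j) + glued s d (s j).
Proof.
case: j => [|j] theta_itv; last exact: glued_next.
by rewrite (glued_first d s_incr theta_itv) (glued_node d s_incr) addr0.
Qed.

Lemma glued_node_growth j :
  glued s d (s j) + (s j.+1 - s j) / 2 <= glued s d (s j.+1).
Proof.
rewrite (@glued_gap j (s j.+1)) ?s_lt ?lexx// addrC lerD2r.
exact: ramp_end_ge.
Qed.

Lemma glued_right_of_node j theta :
  s j <= theta < s j + (s j.+1 - s j) / 16 ->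
  glued s d theta = glued s d (s j) - d j * (theta - s j).
Proof.
rewrite le_eqVlt => /andP[/predU1P[<- _|lt_j lt_r]].
  by rewrite subrr mulr0 subr0.
have := gap_gt0 j => gap.
rewrite (@glued_gap j); last by apply/andP; split; lra.
by rewrite ramp_start//; [ring | apply/andP; split; lra].
Qed.

Lemma glued_left_of_node j theta :
  s j.+1 - (s j.+1 - s j) / 16 <= theta <= s j.+1 ->
  glued s d theta = glued s d (s j.+1) - d j.+1 * (theta - s j.+1).
Proof.
move=> /andP[ge_l le_j]; have := gap_gt0 j => gap.
rewrite (@glued_gap j theta); last by apply/andP; split; lra.
rewrite (@glued_gap j (s j.+1)) ?s_lt ?lexx//.
rewrite ramp_finish//; first by ring.
by apply/andP; split; lra.
Qed.

(** The ramp that ends at a node and the one that begins there have the same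
    slope on one sixteenth of their gaps, so that the graph has no corner at the
    node. At s_0 the affine part on the left replaces the missing ramp. *)
Lemma glued_near_node j :
  \forall theta \near s j,
    glued s d theta = glued s d (s j) - d j * (theta - s j).
Proof.
have right_gt : s j < s j + (s j.+1 - s j) / 16.
  by rewrite ltrDl divr_gt0.
have right_near : \forall theta \near s j,
    theta < s j + (s j.+1 - s j) / 16 by exact: lt_nbhsl.
case: j right_gt right_near => [|j] right_gt right_near.
  near=> theta.
  have [le0|/ltW ge0] := leP theta (s 0%N).
    rewrite (glued_left d le0) (glued_node d s_incr) /=; ring.
  rewrite (glued_right_of_node 0)// ge0 /=; near: theta; exact: right_near.
have left_near : \forall theta \near s j.+1,
    s j.+1 - (s j.+1 - s j) / 16 < theta.
  by apply: lt_nbhsr; rewrite ltrBlDr ltrDl divr_gt0.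
near=> theta.
have [le_j|/ltW ge_j] := leP theta (s j.+1).
  rewrite (glued_left_of_node j)// le_j andbT ltW//; near: theta.
  exact: left_near.
rewrite (glued_right_of_node j.+1)// ge_j /=; near: theta; exact: right_near.
Unshelve. all: by end_near. Qed.

Lemma derive1_glued_node j : (glued s d)^`()%classic (s j) = - d j.
Proof.
rewrite derive1E.
rewrite (near_eq_derive _ (glued_near_node j)).
apply: (@derive_val _ _ _ _ _ _ _ _); apply: is_derive_eq.
by rewrite /GRing.scale /=; ring.
Qed.

End GluedNodes.

Lemma cvgry_of_increments (R : realType) (u : nat -> R) (c : R) :
  0 < c -> (forall j, u j + c <= u j.+1) -> u j @[j --> \oo] --> +oo.
Proof.
move=> c_gt0 u_incr.
have u_ge j : u 0%N + c * j%:R <= u j.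
  elim: j => [|j IHj]; first by rewrite mulr0 addr0.
  apply: le_trans (u_incr j); rewrite mulrSr mulrDr mulr1 addrA.
  by rewrite lerD2r.
apply: (@ger_cvgy _ _ _ _ (fun j => u 0%N + c * j%:R)).
  by near=> j; exact: u_ge.
apply/cvgryPge => A; near=> j.
rewrite -lerBlDl mulrC -ler_pdivrMr//; near: j.
exact: nbhs_infty_ger.
Unshelve. all: by end_near. Qed.

Theorem proposition3p9 (R : realType) (m0 : R) (m0_gt0 : 0 < m0)
    (s d : nat -> R)
    (s0 : s 0%N = 0)
    (sS : forall j : nat, s j.+1 = s j + m0 * (Num.sqrt 5 / 2) ^+ j)
    (dE : forall j : nat, d j = (Num.sqrt 5 / (Num.sqrt 5 + 1)) ^+ j)
    (theta m : nat -> R) (w : nat -> \bar R)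
    (run : lipschitz_approximation (glued s d) 0 m0 theta m w) :
  glued s d (theta j) @[j --> \oo] --> +oo.
Proof.
have r2 : (Num.sqrt 5 : R) ^+ 2 = 5 by rewrite sqr_sqrtr.
set r : R := Num.sqrt 5 in r2 sS dE *.
have r_gt2 : 2 < r by rewrite -(@ltr_pXn2r _ 2) ?nnegrE ?sqrtr_ge0// r2; lra.
have r_neq0 : r != 0 by apply/eqP; lra.
have r1_neq0 : r + 1 != 0 by apply/eqP; lra.
pose phi := (1 + r) / 2; have phiE : phi = (1 + r) / 2 by [].
have phi_gt0 : 0 < phi by rewrite phiE; lra.
have phi_sqrt : Num.sqrt (1 + phi) = phi.
  rewrite (_ : 1 + phi = phi ^+ 2) ?sqrtr_sqr ?gtr0_norm//.
  rewrite phiE; lra.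
have s_lt j : s j < s j.+1.
  by rewrite sS ltrDl mulr_gt0// exprn_gt0//; lra.
have d01 j : 0 < d j <= 1.
  have q01 : 0 < r / (r + 1) <= 1.
    by rewrite divr_gt0 ?ler_pdivrMr; lra.
  rewrite dE; case/andP: q01 => q_gt0 q_le1.
  by rewrite exprn_gt0// exprn_ile1// ltW.
have dF := derive1_glued_node s_lt d01.
have step j : m0 * phi ^+ j * d j = s j.+1 - s j.
  rewrite dE sS [s j + _]addrC addrK -mulrA -exprMn; congr (_ * _ ^+ _).
  by rewrite phiE; field.
(* the second term of the minimum that defines the step size, at a node *)
have secant j : (s j.+1 - s j) / (2 * `|d j - d j.+1|) = m0 * phi ^+ j.+1.
  have d_gt0 : 0 < d j by case/andP: (d01 j).
  have -> : d j.+1 = d j * (r / (r + 1)) by rewrite !dE exprSr.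
  rewrite -step exprSr.
  have -> : d j - d j * (r / (r + 1)) = d j / (r + 1) by field.
  rewrite gtr0_norm; last by rewrite divr_gt0//; lra.
  by rewrite [in RHS]phiE; field; rewrite ?r1_neq0 ?(gt_eqF d_gt0).
(* the ratio w_k is carried along because the growth term at k + 1 needs it;
   w_0 = +oo is the exception *)
have iterates k : [/\ theta k = s k, m k = m0 * phi ^+ k, theta k.+1 = s k.+1 & (0 < k)%N -> w k = phi%:E].
  elim: k => [|k [thk mk thk1 wk]].
    rewrite (la_theta0 run) (la_m0 run) (la_theta1 run) s0 expr0 mulr1.
    split=> //; rewrite -[in LHS]s0 dF sS s0 dE !expr0; ring.
  have mk1 : m k.+1 = m0 * phi ^+ k.+1.
    apply: EFin_inj; rewrite (la_m run)// thk thk1 !dF /=.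
    have -> : `|s k.+1 - s k| = s k.+1 - s k by rewrite gtr0_norm ?subr_gt0.
    rewrite opprK [- _ + _]addrC inver.
    (* the quotient is a real number: a zero denominator would make the
       secant term 0, which [secant] excludes *)
    have d_neq : `|d k - d k.+1| != 0.
      have := secant k; case: eqP => // ->; rewrite mulr0 invr0 mulr0 => /esym.
      by move/eqP; rewrite gt_eqF// mulr_gt0// exprn_gt0.
    rewrite ifF ?mulf_eq0; last by rewrite (negPf d_neq) pnatr_eq0.
    rewrite -EFinM secant mk.
    case: k wk {thk mk thk1 d_neq} => [|k] wk.
      by rewrite (la_w0 run) addey// gt0_mulye ?minye// lte_fin mulr_gt0//
        exprn_gt0.
    by rewrite wk// -EFinD /= phi_sqrt -EFinM mulrCA -exprS /= minxx.
  split=> // [|_].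
    by rewrite (la_theta run)// thk1 dF mk1 mulrN opprK step subrKC.
  rewrite (la_w run)// mk1 /= mk exprS; congr (_%:E).
  by field; rewrite expf_neq0 ?gt_eqF.
have -> : theta = s by apply/funext => k; case: (iterates k).
apply: (@cvgry_of_increments _ _ (m0 / 2)); first by rewrite divr_gt0.
move=> j; apply: le_trans (glued_node_growth s_lt d01 j).
rewrite lerD2l ler_pM2r// sS [s j + _]addrC addrK ler_peMr ?(ltW m0_gt0)//.
by rewrite exprn_ege1//; lra.
Qed.
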